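(* Let $M$ be a finite multiset of integers whose elements sum to $0$, and let $\phi=(\phi_1,\phi_2,\dots)$ be any sequence of permutations with $\phi_i\in\mathfrak S_i$. Then the Order sweep map $\mathrm{Osweep}$ (defined with respect to $\phi$) is a bijection from $\mathcal D_M$ to $\mathcal D_M$.
   Context: A sequence $P=(b_1,\dots,b_N)$ of integers is a general Dyck path if $b_1+\cdots+b_N=0$ and $b_1+\cdots+b_{i-1}\ge 0$ for all $1\le i\le N$. Its type is the multiset $\{b_1,\dots,b_N\}$, and $\mathcal D_M$ denotes the set of general Dyck paths of type $M$. The $i$-th arrow (step) of $P$ is the vector $(1,b_i)$ starting at the point $(i,r_i)$ with starting rank $r_i=b_1+\cdots+b_{i-1}$. Order sweep map: let $k$ be the number of indices $i$ with $r_i=0$, and let $i_1<\dots<i_k$ be these indices. $\mathrm{Osweep}(P)$ is the sequence obtained by listing the steps $b_i$ in the following order: first all arrows of starting rank $0$, then those of starting rank $1$, then $2$, and so on (and finally, for paths with negative ranks, the ranks $-\infty,\dots,-2,-1$ in this order); arrows with the same starting rank $r\neq 0$ are listed from right to left (decreasing index $i$), while the arrows of starting rank $0$ are listed in the order $b_{i_{\phi_k(1)}},b_{i_{\phi_k(2)}},\dots,b_{i_{\phi_k(k)}}$. (When $\phi_k=k\,(k-1)\cdots 1$ for all $k$ this is the usual sweep map.) *)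

(* Defs.v *)
From mathcomp Require Import all_boot all_order all_fingroup all_algebra.
From mathcomp Require Import finmap multiset.
From mathcomp Require Import classical_sets functions.

Set Implicit Arguments.
Unset Strict Implicit.
Unset Printing Implicit Defensive.

Import GRing.Theory Num.Theory.
Local Open Scope ring_scope.

(* Arrows are indexed from 0: b_{i+1} is [nth 0 P i], with starting rank
   r_{i+1} = b_1 + ... + b_i. *)
Definition start_rank (P : seq int) (i : nat) : int := \sum_(b <- take i P) b.

Definition general_dyck (P : seq int) : Prop :=
  \sum_(b <- P) b = 0 /\
  forall i : nat, (i < size P)%N -> 0 <= start_rank P i.

Definition dyck_paths (M : multiset int) : set (seq int) :=
  [set P | general_dyck P /\ seq_mset P = M]%classic.

Definition arrows_of_rank (P : seq int) (r : int) : seq nat :=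
  [seq i <- iota 0 (size P) | start_rank P i == r].

(* [phi k] permutes {0, ..., k-1}; as 'S_0 is trivial, the component [phi 0]
   carries no data. *)
Definition level_order (phi : forall k : nat, 'S_k) (P : seq int) (r : int) :
    seq nat :=
  let s := arrows_of_rank P r in
  if r == 0 then [seq nth 0%N s (phi (size s) j) | j <- enum 'I_(size s)]
  else rev s.

(* Every starting rank of P lies between -B and B for this B. *)
Definition rank_bound (P : seq int) : nat := (\sum_(b <- P) `|b|)%N.

(* 0, 1, ..., B, -B, ..., -2, -1 *)
Definition rank_order (P : seq int) : seq int :=
  [seq n%:Z | n <- iota 0 (rank_bound P).+1] ++
  [seq - n%:Z | n <- rev (iota 1 (rank_bound P))].

Definition osweep_order (phi : forall k : nat, 'S_k) (P : seq int) : seq nat :=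
  flatten [seq level_order phi P r | r <- rank_order P].

Definition Osweep (phi : forall k : nat, 'S_k) (P : seq int) : seq int :=
  [seq nth 0 P i | i <- osweep_order phi P].

(* Main.v *)
Require Import Defs.
From mathcomp Require Import all_boot all_order all_fingroup all_algebra.
From mathcomp Require Import finmap multiset.
From mathcomp Require Import classical_sets functions.
From mathcomp Require Import zify.

Set Implicit Arguments.
Unset Strict Implicit.
Unset Printing Implicit Defensive.

Import Order.TTheory GRing.Theory Num.Theory.
Local Open Scope ring_scope.

(** Reading the arrows in sweep order attaches to the swept word [c] a weakly
    increasing sequence of starting ranks [x] that is balanced: the tails [x j]
    and the heads [x j + c j] agree as multisets.  The pointwise minimum of two
    balanced sequences for the same [c] is again balanced: it has at least as
    many heads as tails below every rank, and moving an arrow shifts its head and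
    its tail by the same amount, so the totals agree.  If that minimum differed
    from the ranks of a Dyck path [P], the last arrow of [P] starting at an
    affected rank would be listed first at its (nonzero) rank, hence be moved
    down, hence point to an affected rank, a contradiction.  So the ranks are
    determined by the swept word, and with them the path, since the listing
    within each rank, whatever [phi] is, is a known permutation.  Thus [Osweep]
    is injective, and it is a self-map of a finite set. *)

(** * Counting the entries of an integer sequence below a rank *)

Definition count_below (n : nat) (x : nat -> int) (r : int) : nat :=
  (\sum_(j < n) (x j < r)%R)%N.

Definition nondecreasing_below (n : nat) (x : nat -> int) : Prop :=
  forall i j, (i <= j < n)%N -> x i <= x j.

Lemma count_below_max n x r : (count_below n x r <= n)%N.
Proof.
rewrite -[leqRHS]card_ord -sum1_card; apply: leq_sum => j _; exact: leq_b1.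
Qed.

(** By monotonicity the entries below [r] form an initial segment, whose length is the count. *)
Lemma nondecreasing_lt_count_below n x r j : nondecreasing_below n x -> (j < n)%N ->
  (x j < r) = (j < count_below n x r)%N.
Proof.
elim: n j => // n IHn j x_mono lt_jn;
  rewrite /count_below big_ord_recr /= -/(count_below n x r).
have x_mono' : nondecreasing_below n x by move=> i k ik; apply: x_mono; lia.
have [xn_lt|xn_ge] := boolP (x n < r).
  have -> : count_below n x r = n.
    rewrite /count_below (eq_bigr (fun=> 1%N)) ?sum1_card ?card_ord // => i _.
    by rewrite (le_lt_trans (x_mono i n _) xn_lt) //; have := ltn_ord i; lia.
  by rewrite addn1 lt_jn (le_lt_trans (x_mono j n _) xn_lt) //; lia.
rewrite addn0; have [lt_jn'|le_nj] := ltnP j n; first exact: IHn.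
have -> : j = n by lia.
by rewrite (negPf xn_ge); have := count_below_max n x r; lia.
Qed.

Lemma count_below_leq n x y r : (forall j, (j < n)%N -> y j <= x j) ->
  (count_below n x r <= count_below n y r)%N.
Proof.
move=> le_yx; apply: leq_sum => j _.
have := le_yx j (ltn_ord j); case: ltP; case: ltP => //; lia.
Qed.

Lemma count_below_ltn n x y r j : (forall j, (j < n)%N -> y j <= x j) ->
  (j < n)%N -> y j < r <= x j -> (count_below n x r < count_below n y r)%N.
Proof.
move=> le_yx lt_jn yrx; rewrite /count_below.
rewrite (bigD1 (Ordinal lt_jn)) //= [ltnRHS](bigD1 (Ordinal lt_jn)) //=.
have -> : (x j < r) = false by lia.
have -> : (y j < r) = true by lia.
rewrite add0n add1n ltnS; apply: leq_sum => i _.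
have := le_yx i (ltn_ord i); case: ltP; case: ltP => //; lia.
Qed.

(** After exchanging the sums, [x j] is counted once for each [r] with [x j < r <= B]. *)
Lemma sum_count_below n x (B : nat) : (forall j, (j < n)%N -> 0 <= x j <= B%:Z) ->
  (\sum_(r < B.+1) count_below n x r%:Z)%N%:Z = \sum_(j < n) (B%:Z - x j).
Proof.
move=> x_bd; rewrite exchange_big /= -[Posz _]natz natr_sum; apply: eq_bigr => j _.
have := x_bd j (ltn_ord j); move: (x j) => {x x_bd j} x.
elim: B => [|B IHB] x_bd; first by rewrite big_ord1 natz; case: ltP => /=; lia.
rewrite big_ord_recr /= natrD !natz.
have [xB|xB] := leP x B%:Z; first by rewrite -natz IHB; [case: ltP => /=;
  lia | lia].
rewrite big1; first by case: ltP => /=; lia.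
by move=> i _; have := ltn_ord i; case: ltP => //; lia.
Qed.

Lemma sum_leq_eq (I : finType) (F G : I -> nat) :
  (forall i, F i <= G i)%N -> (\sum_i F i = \sum_i G i)%N -> F =1 G.
Proof.
move=> le_FG eq_sum i; apply/eqP.
have /leqifP := leqif_sum (fun i (_ : xpredT i) => leqif_eq (le_FG i)).
by rewrite eq_sum; case: forallP => [/(_ i) //|_]; rewrite ltnn.
Qed.

(** * The pointwise minimum of two balanced sequences *)

Lemma nondecreasing_min n x y : nondecreasing_below n x ->
  nondecreasing_below n y ->
  nondecreasing_below n (fun j => Order.min (x j) (y j)).
Proof.
by move=> x_mono y_mono i j ij; have := x_mono _ _ ij; have := y_mono _ _ ij; lia.
Qed.

Lemma meet_moved_tail n x y j : (j < n)%N -> y j < x j ->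
  (count_below n x (x j) < count_below n (fun j => Order.min (x j) (y j)) (x j))%N.
Proof. by move=> lt_jn yx; apply: (@count_below_ltn _ _ _ _ j) => // [i _|];
  lia. Qed.

(** A rank is affected when [m] has more entries below it than [x]. Position [count_below n x r]
    then still lies in the initial segment where [m] is below [r]. *)
Lemma meet_first_moved n x y (m := fun j => Order.min (x j) (y j)) r :
  nondecreasing_below n x -> nondecreasing_below n y ->
  (count_below n x r < count_below n m r)%N -> m (count_below n x r) < r.
Proof.
move=> x_mono y_mono lt_cnt.
rewrite (nondecreasing_lt_count_below _ (nondecreasing_min x_mono y_mono)) //.
exact: leq_trans lt_cnt (count_below_max _ _ _).
Qed.

Section Meet.

Variables (n B : nat) (c x y : nat -> int).
Hypothesis sum_c : \sum_(j < n) c j = 0.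
Hypotheses (x_mono : nondecreasing_below n x) (y_mono : nondecreasing_below n y).
Hypothesis x_bd : forall j, (j < n)%N ->
  (0 <= x j <= B%:Z) /\ (0 <= x j + c j <= B%:Z).
Hypothesis y_bd : forall j, (j < n)%N ->
  (0 <= y j <= B%:Z) /\ (0 <= y j + c j <= B%:Z).
Hypothesis x_bal : forall r, count_below n (fun j => x j + c j) r =
  count_below n x r.
Hypothesis y_bal : forall r, count_below n (fun j => y j + c j) r =
  count_below n y r.

Let m j := Order.min (x j) (y j).

Let m_mono : nondecreasing_below n m.
Proof. exact: nondecreasing_min. Qed.

(** Tails of [m] below [r] fill the longer of two initial segments, and lowering heads only raises
    their count, so heads are at least as many as tails. As [c] sums to zero, the totals over all
    ranks agree, which forces equality at each rank. *)
Lemma meet_balanced (r : nat) : (r <= B)%N ->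
  count_below n (fun j => m j + c j) r%:Z = count_below n m r%:Z.
Proof.
move=> le_rB; symmetry.
pose F (r : 'I_B.+1) := count_below n m r%:Z.
pose G (r : 'I_B.+1) := count_below n (fun j => m j + c j) r%:Z.
suff /(_ (Ordinal (le_rB : (r < B.+1)%N))) : F =1 G by [].
apply: sum_leq_eq => [{le_rB}r'|].
  have cnt_m : (F r' <= maxn (count_below n x r'%:Z) (count_below n y r'%:Z))%N.
    case E: (F r') => [//|k].
    have lt_kn : (k < n)%N by have := count_below_max n m r'%:Z; rewrite -/(F r') E.
    have : m k < r'%:Z by rewrite (nondecreasing_lt_count_below _ m_mono) //
      -/(F r') E.
    rewrite gt_min (nondecreasing_lt_count_below _ x_mono) //.
    by rewrite (nondecreasing_lt_count_below _ y_mono) // leq_max.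
  apply: leq_trans cnt_m _; rewrite geq_max -x_bal -y_bal.
  by apply/andP; split; apply: count_below_leq => j _; rewrite /m; lia.
apply/eqP; rewrite -eqz_nat !sum_count_below.
- rewrite -subr_eq0 -sumrB.
  rewrite (eq_bigr (fun j : 'I_n => c j)) ?sum_c // => j _; lia.
- by move=> j lt_jn; have := x_bd lt_jn; have := y_bd lt_jn; rewrite /m; lia.
- by move=> j lt_jn; have := x_bd lt_jn; have := y_bd lt_jn; rewrite /m; lia.
Qed.

(** Lowering a tail lowers its head equally, so [m] has more heads than [x] below the old head.
    Balance turns both counts into counts of tails: the old head is an affected rank. *)
Lemma meet_moved_head j : (j < n)%N -> m j < x j ->
  (count_below n x (x j + c j) < count_below n m (x j + c j))%N.
Proof.
move=> lt_jn mx; have [_ h_bd] := x_bd lt_jn.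
have [h Eh] : exists h : nat, x j + c j = h%:Z by exists (absz (x j + c j)); lia.
rewrite Eh -meet_balanced; last lia.
by rewrite -x_bal; apply: (@count_below_ltn _ _ _ _ j) => // [i _|];
  rewrite /m in mx *; lia.
Qed.

End Meet.

(** * Starting ranks along a path *)

Lemma start_rankS P i : (i < size P)%N ->
  start_rank P i.+1 = start_rank P i + nth 0 P i.
Proof. by move=> lt_i; rewrite /start_rank (take_nth 0) // big_rcons /= addrC. Qed.

Lemma start_rank0 P : start_rank P 0 = 0.
Proof. by rewrite /start_rank take0 big_nil. Qed.

Lemma start_rank_size P : start_rank P (size P) = \sum_(b <- P) b.
Proof. by rewrite /start_rank take_size. Qed.

Lemma start_rank_le P i : start_rank P i <= (rank_bound P)%:Z.
Proof.
rewrite /rank_bound -natz natr_sum.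
rewrite -[in leRHS](cat_take_drop i P) big_cat /= -[leLHS]addr0 /start_rank.
by apply: lerD; [apply: ler_sum | apply: sumr_ge0] => b _; rewrite natz; lia.
Qed.

Lemma dyck_start_rank_ge0 P i : general_dyck P -> (i <= size P)%N ->
  0 <= start_rank P i.
Proof.
move=> [sumP posP]; rewrite leq_eqVlt => /orP[/eqP->|]; last exact: posP.
by rewrite start_rank_size sumP.
Qed.

(** The two lists differ only by the final and the initial rank, both 0. *)
Lemma perm_heads_tails P : \sum_(b <- P) b = 0 ->
  perm_eq [seq start_rank P i.+1 | i <- iota 0 (size P)]
          [seq start_rank P i | i <- iota 0 (size P)].
Proof.
move=> sumP; rewrite -(perm_cons (start_rank P 0)).
have -> : [seq start_rank P i.+1 | i <- iota 0 (size P)]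
          = [seq start_rank P i | i <- iota 1 (size P)].
  by rewrite (iotaDl 1 0) -map_comp.
rewrite -map_cons -[0%N :: _]/(iota 0 (size P).+1) -addn1 iotaD map_cat /= add0n.
by rewrite start_rank_size sumP start_rank0 cats1 perm_rcons.
Qed.

(** * Rearrangements within and across rank levels *)

Lemma perm_map_nth_ord (T : eqType) (x0 : T) (s : seq T) (p : 'S_(size s)) :
  perm_eq [seq nth x0 s (p j) | j <- enum 'I_(size s)] s.
Proof.
have perm_p : perm_eq (map p (enum 'I_(size s))) (enum 'I_(size s)).
  apply: uniq_perm; rewrite ?(map_inj_uniq perm_inj) ?enum_uniq //.
  move=> i; rewrite mem_enum; apply/mapP; exists (p^-1%g i); rewrite ?mem_enum //.
  by rewrite permKV.
have /(perm_map (fun j : 'I_(size s) => nth x0 s j)) := perm_p.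
rewrite -map_comp => /perm_trans; apply.
by rewrite (map_comp (nth x0 s) val) val_enum_ord map_nth_iota0 ?take_size
  ?perm_refl.
Qed.

Lemma perm_level_order phi P r : perm_eq (level_order phi P r) (arrows_of_rank P r).
Proof.
rewrite /level_order; case: ifP => _; first exact: perm_map_nth_ord.
by rewrite perm_rev perm_refl.
Qed.

Lemma mem_level_order phi P r i :
  (i \in level_order phi P r) = (i < size P)%N && (start_rank P i == r).
Proof.
by rewrite (perm_mem (perm_level_order _ _ _)) mem_filter mem_iota andbC.
Qed.

(** Fibers over distinct values are disjoint, so the counts of any predicate add up. *)
Lemma perm_flatten_fibers (T S : eqType) (f : T -> S) (F : S -> seq T)
    (s : seq T) (rs : seq S) :
  uniq rs -> (forall r, r \in rs -> perm_eq (F r) [seq i <- s | f i == r]) ->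
  perm_eq (flatten [seq F r | r <- rs]) [seq i <- s | f i \in rs].
Proof.
elim: rs => [_ _|r rs IHrs /= /andP[r_rs uniq_rs] permF].
  by rewrite (eq_filter (a2 := pred0)) ?filter_pred0.
apply/seq.permP => a; rewrite count_cat (seq.permP (permF r (mem_head _ _))).
rewrite (seq.permP (IHrs uniq_rs _)) => [|r' rs_r']; last first.
  by apply: permF; rewrite inE rs_r' orbT.
rewrite !count_filter -count_predUI [X in (_ + X)%N](eq_count (a2 := pred0)).
  rewrite count_pred0 addn0; apply: eq_count => i /=.
  by rewrite inE andb_orr.
by move=> i /=; case: eqP => [->|]; rewrite ?(negPf r_rs) ?andbF.
Qed.

(** * The sweep order of a Dyck path and its sequence of ranks *)

Section Dyck.

Variables (phi : forall k : nat, 'S_k) (P : seq int).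
Hypothesis dyckP : general_dyck P.

Let N := size P.
Let o := osweep_order phi P.

Lemma osweep_order_nonneg : o =
  flatten [seq level_order phi P n%:Z | n <- iota 0 (rank_bound P).+1].
Proof.
rewrite /o /osweep_order /rank_order map_cat flatten_cat -!map_comp.
rewrite [X in _ ++ X](_ : _ = [::]) ?cats0 //.
apply/nilP; rewrite /nilp -all_pred0; apply/allP => i /flatten_mapP[n].
rewrite mem_rev mem_iota /= mem_level_order => n_gt0 /andP[lt_iN /eqP rank_i].
by have := dyck_start_rank_ge0 dyckP (ltnW lt_iN); lia.
Qed.

Lemma perm_osweep_order : perm_eq o (iota 0 N).
Proof.
rewrite osweep_order_nonneg.
(* [absz] is a natural key equal to the rank, which is nonnegative and bounded by [rank_bound]; the
   filter keeps every arrow. *)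
have -> : iota 0 N = [seq i <- iota 0 N |
    absz (start_rank P i) \in iota 0 (rank_bound P).+1].
  symmetry; apply/all_filterP/allP => i; rewrite !mem_iota /= => /ltnW lt_iN.
  by have := dyck_start_rank_ge0 dyckP lt_iN; have := start_rank_le P i; lia.
apply: perm_flatten_fibers (iota_uniq _ _) _ => n _.
apply: perm_trans (perm_level_order _ _ _) _.
rewrite /arrows_of_rank (eq_in_filter (a2 := fun i =>
  absz (start_rank P i) == n)) //.
move=> i; rewrite mem_iota /= => /ltnW lt_iN.
by have := dyck_start_rank_ge0 dyckP lt_iN; lia.
Qed.

Lemma size_osweep_order : size o = N.
Proof. by rewrite (perm_size perm_osweep_order) size_iota. Qed.

Lemma nth_osweep_order_lt j : (j < N)%N -> (nth 0%N o j < N)%N.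
Proof.
rewrite -{1}size_osweep_order => /(mem_nth 0%N).
by rewrite (perm_mem perm_osweep_order) mem_iota.
Qed.

Definition swept_rank (j : nat) : int := start_rank P (nth 0%N o j).

Lemma swept_rank_mono : nondecreasing_below N swept_rank.
Proof.
suff : pairwise <=%O (map (start_rank P) o).
  move=> /(pairwiseP 0) mono i j /andP[]; rewrite leq_eqVlt => /orP[/eqP->//|ij] jN.
  have iN := ltn_trans ij jN; have := mono i j.
  by rewrite !inE size_map size_osweep_order !(nth_map 0%N) ?size_osweep_order
    //; apply.
rewrite osweep_order_nonneg; move: (rank_bound P).+1 => k.
elim: k (0%N) => //= k IHk m.
rewrite map_cat pairwise_cat IHk andbT; apply/andP; split.
  apply/allrelP => _ _ /mapP[i Hi ->] /mapP[j /flatten_mapP[n Hn Hj] ->].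
  move: Hi Hj Hn; rewrite !mem_level_order mem_iota =>
    /andP[_ /eqP->] /andP[_ /eqP->]; lia.
apply/(pairwiseP 0) => a b; rewrite !inE => aL bL _.
have /mapP[i] := mem_nth 0 aL; rewrite mem_level_order => /andP[_ /eqP->] ->.
by have /mapP[j] := mem_nth 0 bL; rewrite mem_level_order => /andP[_ /eqP->] ->.
Qed.

Lemma count_below_swept (f : nat -> int) r :
  count_below N (fun j => f (nth 0%N o j)) r = count (fun i => f i < r) (iota 0 N).
Proof.
rewrite -(seq.permP perm_osweep_order) /count_below -size_osweep_order
  -sum1_count (big_nth 0%N) big_mkord.
by rewrite [RHS]big_mkcond; apply: eq_bigr => j _; case: ifP.
Qed.

Lemma nth_Osweep j : (j < N)%N -> nth 0 (Osweep phi P) j = nth 0 P (nth 0%N o j).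
Proof. by move=> lt_jN; rewrite (nth_map 0%N) ?size_osweep_order. Qed.

Lemma swept_head j : (j < N)%N ->
  swept_rank j + nth 0 (Osweep phi P) j = start_rank P (nth 0%N o j).+1.
Proof.
by move=> lt_jN; rewrite start_rankS ?nth_osweep_order_lt ?nth_Osweep.
Qed.

Lemma swept_balanced r :
  count_below N (fun j => swept_rank j + nth 0 (Osweep phi P) j) r =
    count_below N swept_rank r.
Proof.
rewrite (count_below_swept (start_rank P)).
have -> : count_below N (fun j => swept_rank j + nth 0 (Osweep phi P) j) r =
          count_below N (fun j => start_rank P (nth 0%N o j).+1) r.
  by apply: eq_bigr => j _; rewrite swept_head.
rewrite (count_below_swept (fun i => start_rank P i.+1)).
by have /seq.permP/(_ (fun z => z < r)) := perm_heads_tails dyckP.1;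
  rewrite !count_map.
Qed.

Lemma swept_bounds j : (j < N)%N ->
  (0 <= swept_rank j <= (rank_bound P)%:Z) /\
  (0 <= swept_rank j + nth 0 (Osweep phi P) j <= (rank_bound P)%:Z).
Proof.
move=> lt_jN; have lt_oN := nth_osweep_order_lt lt_jN.
rewrite swept_head // /swept_rank !start_rank_le.
by rewrite !dyck_start_rank_ge0 // ltnW.
Qed.

(** Nonzero ranks are listed from right to left, so the last arrow at its rank opens its block, and
    the block begins after all arrows of lower rank. At rank 0 the order is decided by [phi]
    instead. *)
Lemma last_exit_position i : (i < N)%N -> start_rank P i != 0 ->
  (forall k, (i < k < N)%N -> start_rank P k != start_rank P i) ->
  nth 0%N o (count_below N swept_rank (start_rank P i)) = i.
Proof.
move=> lt_iN ri_neq0 last_i.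
have [m Em] : exists m : nat, start_rank P i = m%:Z.
  exists (absz (start_rank P i)).
  by have := dyck_start_rank_ge0 dyckP (ltnW lt_iN); lia.
have le_mB : (m <= rank_bound P)%N by have := start_rank_le P i; rewrite Em; lia.
rewrite (count_below_swept (start_rank P)) -(seq.permP perm_osweep_order)
  osweep_order_nonneg.
(* Ranks split into those below [m], [m] itself and those above; only the first group enters the
   count. *)
have -> : (rank_bound P).+1 = (m + (1 + (rank_bound P - m)))%N by lia.
rewrite !iotaD !map_cat !flatten_cat /= cats0 add0n !count_cat.
rewrite [X in nth _ _ (_ + X)%N](_ : _ = 0%N); last first.
  apply/eqP; rewrite addn_eq0 !eqn0Ngt -!has_count; apply/andP; split.
    by apply/hasPn => k; rewrite mem_level_order Em => /andP[_ /eqP->]; lia.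
  apply/hasPn => k /flatten_mapP[n]; rewrite mem_iota mem_level_order Em.
  by move=> Hn /andP[_ /eqP->]; lia.
rewrite addn0 (_ : count _ _ = size (flatten [seq level_order phi P n%:Z | n <-
  iota 0 m]));
  last first.
  apply/eqP; rewrite -all_count; apply/allP => k /flatten_mapP[n].
  by rewrite mem_iota mem_level_order Em => Hn /andP[_ /eqP->]; lia.
rewrite nth_cat ltnn subnn /level_order -Em (negPf ri_neq0) /arrows_of_rank.
have -> : size P = (i + (1 + (N - i.+1)))%N by rewrite /N in lt_iN *; lia.
rewrite !iotaD !filter_cat /= add0n eqxx [filter _ (iota (i + 1) _)](_ : _ = [::]).
  by rewrite cats1 rev_rcons.
apply/eqP/negPn; rewrite -has_filter -all_predC; apply/allP => k /=.
by rewrite mem_iota => Hk; apply: last_i; lia.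
Qed.

End Dyck.

(** * The swept word is a Dyck path of the same type *)

Lemma perm_Osweep phi P : general_dyck P -> perm_eq (Osweep phi P) P.
Proof.
move=> dyckP; have /(perm_map (nth 0 P)) := perm_osweep_order phi dyckP.
by rewrite map_nth_iota0 ?take_size.
Qed.

(* A prefix of the sweep consists of arrows with the smallest tails, while heads
   and tails agree as multisets: truncating both at the rank [r] reached by the
   prefix shows that its heads sum to at least as much as its tails. *)
Lemma Osweep_dyck phi P : general_dyck P -> general_dyck (Osweep phi P).
Proof.
move=> dyckP; have permQ := perm_Osweep phi dyckP.
split=> [|m]; first by rewrite (perm_big _ permQ) dyckP.1.
rewrite (perm_size permQ) => lt_mN.
set Q := Osweep phi P; pose r := swept_rank phi P m.
pose g (z : int) := Order.min (z - r) 0.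
pose t := swept_rank phi P; pose h j := t j + nth 0 Q j.
have sum_g : \sum_(0 <= j < size P) (g (h j) - g (t j)) = 0.
  have sum_perm (f : nat -> int) : \sum_(0 <= j < size P) f (nth 0%N
    (osweep_order phi P) j)
      = \sum_(i <- iota 0 (size P)) f i.
    by rewrite -(perm_big _ (perm_osweep_order phi dyckP)) [RHS](big_nth 0%N)
      size_osweep_order.
  rewrite sumrB (sum_perm (fun i => g (start_rank P i))).
  rewrite (eq_big_nat _ _ (F2 := fun j =>
    g (start_rank P (nth 0%N (osweep_order phi P) j).+1))).
    rewrite (sum_perm (fun i => g (start_rank P i.+1))).
    rewrite -(big_map (start_rank P \o S) xpredT g) -(big_map (start_rank P)
      xpredT g).
    by rewrite (perm_big _ (perm_heads_tails dyckP.1)) subrr.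
  by move=> j /andP[_ lt_jN]; rewrite /h swept_head.
rewrite (big_cat_nat (n := m)) //= in sum_g; last exact: ltnW.
have le_r j : (j <= m)%N -> t j <= r.
  by move=> le_jm; apply: (swept_rank_mono phi dyckP); rewrite le_jm.
have ge_r j : (m <= j < size P)%N -> r <= t j by move/(swept_rank_mono phi dyckP).
(* From [m] on, tails are at least [r], where [g] vanishes, and [g] is never positive. *)
have tail_le0 : \sum_(m <= j < size P) (g (h j) - g (t j)) <= 0.
  rewrite big_nat_cond; apply: sumr_le0 => j /andP[Hj _].
  by have := ge_r j Hj; rewrite /g; lia.
have -> : start_rank Q m = \sum_(0 <= j < m) nth 0 Q j.
  rewrite /start_rank (big_nth 0) size_takel ?(perm_size permQ) 1?ltnW //.
  by apply: eq_big_nat => j /andP[_ lt_jm]; rewrite nth_take.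
(* Before [m], tails are at most [r], where [g z = z - r]; truncating the head can only lower the
   difference. *)
have : \sum_(0 <= j < m) (g (h j) - g (t j)) <= \sum_(0 <= j < m) nth 0 Q j.
  rewrite ler_sum_nat // => j /andP[_ /ltnW/le_r].
  by rewrite /g /h; move: (t j) (nth 0 Q j) => a b; lia.
by apply: le_trans; move/eqP: sum_g; rewrite addr_eq0 => /eqP->; rewrite oppr_ge0.
Qed.

(** * The swept word determines the ranks *)

Lemma rank_bound_perm P Q : perm_eq P Q -> rank_bound P = rank_bound Q.
Proof. exact: perm_big. Qed.

(** One inequality suffices, since [P] and [P'] can be exchanged. It follows once no starting rank
    of [P] is affected by passing to the minimum. *)
Lemma swept_rank_le phi P P' : general_dyck P -> general_dyck P' ->
  Osweep phi P = Osweep phi P' ->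
  forall j, (j < size P)%N -> swept_rank phi P j <= swept_rank phi P' j.
Proof.
move=> dyckP dyckP' eqQ.
have permQ := perm_Osweep phi dyckP; have permQ' := perm_Osweep phi dyckP'.
have perm_PP' : perm_eq P P'.
  by apply: perm_trans permQ'; rewrite -eqQ perm_sym.
pose N := size P; have size_P' : size P' = N by rewrite -(perm_size perm_PP').
pose x := swept_rank phi P; pose y := swept_rank phi P'.
pose c j := nth 0 (Osweep phi P) j.
pose m j := Order.min (x j) (y j).
have sum_c : \sum_(j < N) c j = 0.
  rewrite -[RHS]dyckP.1 -(perm_big _ permQ) [RHS](big_nth 0) big_mkord.
  by rewrite (perm_size permQ).
have x_mono : nondecreasing_below N x := swept_rank_mono phi dyckP.
have y_mono : nondecreasing_below N y by rewrite -size_P'; exact: swept_rank_mono.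
have x_bd j : (j < N)%N -> (0 <= x j <= (rank_bound P)%:Z) /\
    (0 <= x j + c j <= (rank_bound P)%:Z) by exact: swept_bounds.
have y_bd j : (j < N)%N -> (0 <= y j <= (rank_bound P)%:Z) /\
    (0 <= y j + c j <= (rank_bound P)%:Z).
  by rewrite (rank_bound_perm perm_PP') /c eqQ -size_P'; exact: swept_bounds.
have x_bal r : count_below N (fun j => x j + c j) r =
  count_below N x r by exact: swept_balanced.
have y_bal r : count_below N (fun j => y j + c j) r = count_below N y r.
  by rewrite /c eqQ -size_P'; exact: swept_balanced.
pose bad r := (count_below N x r < count_below N m r)%N.
(* Both rank sequences are nonnegative, so their minimum has no entry below 0. *)
have bad0 : ~~ bad 0.
  rewrite /bad -leqNgt /count_below [leqLHS]big1 // => j _.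
  by have := x_bd j (ltn_ord j); have := y_bd j (ltn_ord j); rewrite /m;
    case: ltP; lia.
have no_bad i : (i < N)%N -> ~~ bad (start_rank P i).
  (* Induction on a bound for [N - i] treats the arrows from the last one backwards. *)
  have [k] := ubnP (N - i); elim: k i => // k IHk i lt_k lt_iN; apply/negP => bad_i.
  have later j : (i < j < N)%N -> ~~ bad (start_rank P j) by move=> Hj;
    apply: IHk; lia.
  (* The rank of [i] is nonzero by [bad0], and by [later] no later arrow starts at this bad rank. *)
  have pos_i : nth 0%N (osweep_order phi P) (count_below N x (start_rank P i)) = i.
    apply: last_exit_position => //; first by apply: contraNneq bad0 => <-.
    by move=> j /later; apply: contraNneq => ->.
  have lt_pN := leq_trans bad_i (count_below_max _ _ _).
  have x_pos : x (count_below N x (start_rank P i)) = start_rank P i.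
    by rewrite {1}/x /swept_rank pos_i.
  have moved := meet_first_moved x_mono y_mono bad_i; rewrite x_pos in moved.
  have := meet_moved_head sum_c x_mono y_mono x_bd y_bd x_bal y_bal lt_pN.
  rewrite x_pos /c nth_Osweep // pos_i -start_rankS // => /(_ moved) bad_head.
  (* The bad head is either the tail of the next arrow, against [later], or the end of the path at
     rank 0, against [bad0]. *)
  have [lt_iN'|] := ltnP i.+1 N; first by have := later i.+1;
    rewrite ltnSn lt_iN' /bad bad_head => /(_ isT).
  move=> ge_iN; have EN : i.+1 = size P by apply/eqP; rewrite eqn_leq lt_iN.
  by move: bad0; rewrite -[X in bad X]dyckP.1 -start_rank_size -EN /bad bad_head.
move=> j lt_jN; rewrite leNgt; apply/negP => lt_yx.
have /negP := no_bad _ (nth_osweep_order_lt phi dyckP lt_jN).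
by apply; apply: meet_moved_tail lt_yx.
Qed.

Lemma swept_rank_eq phi P P' : general_dyck P -> general_dyck P' ->
  Osweep phi P = Osweep phi P' ->
  [seq start_rank P i | i <- osweep_order phi P] =
  [seq start_rank P' i | i <- osweep_order phi P'].
Proof.
move=> dyckP dyckP' eqQ.
have size_PP' : size P = size P'.
  by rewrite -(perm_size (perm_Osweep phi dyckP)) eqQ (perm_size (perm_Osweep
    phi dyckP')).
apply: (@eq_from_nth _ 0); rewrite !size_map !size_osweep_order // => j lt_jN.
rewrite !(nth_map 0%N) ?size_osweep_order -?size_PP' //.
apply/eqP; rewrite eq_le (swept_rank_le dyckP dyckP' eqQ) //.
by rewrite (swept_rank_le dyckP' dyckP (esym eqQ)) // -size_PP'.
Qed.

(** * Recovering the path from its ranks and its swept word *)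

Definition steps_of_rank (P : seq int) (r : int) : seq int :=
  [seq nth 0 P i | i <- arrows_of_rank P r].

(** Dropping the first arrow shifts all later starting ranks by [- b]. *)
Lemma steps_of_rank_cons b P r :
  steps_of_rank (b :: P) r =
    if r == 0 then b :: steps_of_rank P (r - b) else steps_of_rank P (r - b).
Proof.
have tail_eq : [seq nth 0 (b :: P) i | i <- iota 1 (size P) & start_rank (b ::
  P) i == r]
    = steps_of_rank P (r - b).
  rewrite (iotaDl 1 0) filter_map -map_comp /steps_of_rank /arrows_of_rank.
  congr map; apply: eq_filter => i /=.
  by rewrite /start_rank /= big_cons addrC eq_sym [RHS]eq_sym subr_eq.
by rewrite {1}/steps_of_rank /arrows_of_rank /= start_rank0 eq_sym;
  case: ifP => /= _; rewrite tail_eq.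
Qed.

(** The first arrow starts at rank 0, so it is the first step listed there; it is peeled off and the
    ranks are shifted. Arbitrary words are covered because the tail of a Dyck path need not sum to
    zero. *)
Lemma steps_of_rank_inj P P' : steps_of_rank P =1 steps_of_rank P' -> P = P'.
Proof.
elim: P P' => [|b P IHP] [|b' P'] //= eq_steps.
- by have := eq_steps 0; rewrite steps_of_rank_cons.
- by have := eq_steps 0; rewrite steps_of_rank_cons.
have Eb : b = b' by have := eq_steps 0; rewrite !steps_of_rank_cons eqxx => -[].
rewrite -{}Eb in eq_steps *; congr cons; apply: IHP => r.
have := eq_steps (r + b); rewrite !steps_of_rank_cons addrK.
by case: ifP => // _ [].
Qed.

(** Equal sizes select the same permutation, so entry [k] is read off at its preimage. *)
Lemma map_perm_nth_inj (S T : Type) (y0 : S) (f f' : S -> T) (s s' : seq S)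
    (phi : forall k : nat, 'S_k) : size s = size s' ->
  map f [seq nth y0 s (phi (size s) j) | j <- enum 'I_(size s)] =
  map f' [seq nth y0 s' (phi (size s') j) | j <- enum 'I_(size s')] ->
  map f s = map f' s'.
Proof.
move=> eq_size; rewrite -eq_size -map_comp -[RHS]map_comp => eq_map.
apply: (@eq_from_nth _ (f y0)) => [|k]; rewrite !size_map // => lt_k.
rewrite !(nth_map y0) -?eq_size //.
have /eq_in_map/(_ ((phi (size s))^-1%g (Ordinal lt_k))) := eq_map.
by rewrite mem_enum /= permKV; apply.
Qed.

(** Equal swept ranks give equal block sizes, so the common word is cut at the same places. Undoing
    the order inside each block then gives the steps at each rank. *)
Lemma Osweep_inj phi P P' : general_dyck P -> general_dyck P' ->
  Osweep phi P = Osweep phi P' -> P = P'.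
Proof.
move=> dyckP dyckP' eqQ; have eq_ranks := swept_rank_eq dyckP dyckP' eqQ.
have permQ := perm_Osweep phi dyckP; have permQ' := perm_Osweep phi dyckP'.
have eqB : rank_bound P = rank_bound P'.
  by apply: rank_bound_perm; apply: perm_trans permQ'; rewrite -eqQ perm_sym.
have size_arrows R r : general_dyck R -> size (arrows_of_rank R r) =
    count_mem r [seq start_rank R i | i <- osweep_order phi R].
  by move=> dyckR; rewrite size_filter count_map -(seq.permP (perm_osweep_order
    phi dyckR)).
have eq_size r : size (arrows_of_rank P r) = size (arrows_of_rank P' r).
  by rewrite !size_arrows // eq_ranks.
pose blocks R := [seq [seq nth 0 R i | i <- level_order phi R r] | r <-
  rank_order R].
have OsweepE R : Osweep phi R = flatten (blocks R).
  by rewrite /Osweep /osweep_order map_flatten -map_comp.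
have eq_order : rank_order P = rank_order P' by rewrite /rank_order eqB.
have eq_blocks : blocks P = blocks P'.
  apply: eq_from_flatten_shape; first by rewrite -!OsweepE.
  rewrite /shape /blocks -!map_comp eq_order; apply: eq_map => r /=.
  by rewrite !size_map !(perm_size (perm_level_order _ _ _)) eq_size.
apply: steps_of_rank_inj => r.
(* Starting ranks lie between 0 and [rank_bound], so ranks outside the list carry no arrows. *)
have [r_in|r_out] := boolP (r \in rank_order P); last first.
  suff arrows0 R : general_dyck R -> rank_order P =
    rank_order R -> arrows_of_rank R r = [::].
    by rewrite /steps_of_rank !arrows0.
  move=> dyckR eqR; apply/nilP; rewrite /nilp -all_pred0; apply/allP => i.
  rewrite mem_filter mem_iota /= => /andP[/eqP ri /ltnW lt_i].
  case/negP: r_out; rewrite eqR mem_cat; apply/orP; left.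
  apply/mapP; exists (absz r); first rewrite mem_iota /=;
    have := dyck_start_rank_ge0 dyckR lt_i; have := start_rank_le R i; lia.
have /eq_in_map/(_ r r_in) : [seq [seq nth 0 P i | i <- level_order phi P r] |
  r <- rank_order P]
    = [seq [seq nth 0 P' i | i <- level_order phi P' r] | r <- rank_order P].
  by rewrite {2}eq_order.
rewrite /level_order; case: ifP => _; last first.
  by rewrite !map_rev => /(congr1 rev); rewrite !revK.
exact: map_perm_nth_inj.
Qed.

(** * From injectivity to bijectivity on a finite set *)

(** Pigeonhole: the image of [s] is duplicate-free, inside [s] and as long as [s]. *)
Lemma inj_homo_surj_finite (T : eqType) (s : seq T) (f : T -> T) :
  uniq s -> {in s &, injective f} -> {homo f : x / x \in s} ->
  forall y, y \in s -> exists2 x, x \in s & f x = y.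
Proof.
move=> uniq_s f_inj f_homo y y_s.
have [|| _ mem_s] := @uniq_min_size _ (map f s) s _ _ (eq_leq (esym (size_map f
  s))).
- by rewrite map_inj_in_uniq.
- by move=> _ /mapP[x x_s ->]; exact: f_homo.
by move: y_s; rewrite -mem_s => /mapP[x x_s ->]; exists x.
Qed.

(** The boolean form lets [dyck_paths M] be listed by filtering the permutations of [M]. *)
Definition is_general_dyck (P : seq int) : bool :=
  (\sum_(b <- P) b == 0) && all (fun i => 0 <= start_rank P i) (iota 0 (size P)).

Lemma is_general_dyckP P : reflect (general_dyck P) (is_general_dyck P).
Proof.
apply: (iffP andP) => -[sumP posP]; split.
- exact/eqP.
- by move=> i lt_i; apply: (allP posP); rewrite mem_iota.
- exact/eqP.
- by apply/allP => i; rewrite mem_iota; exact: posP.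
Qed.

Theorem theorem1 (M : multiset int) (phi : forall k : nat, 'S_k)
    (sumM0 : (\sum_(b <- M) b)%R = 0%R) :
  set_bij (dyck_paths M) (dyck_paths M) (Osweep phi).
Proof.
pose s := [seq P <- permutations (M : seq int) | is_general_dyck P].
have memE P : dyck_paths M P <-> P \in s.
  rewrite mem_filter mem_permutations /dyck_paths /=; split.
    by case=> /is_general_dyckP -> /= <-; rewrite perm_sym perm_eq_seq_mset.
  case/andP=> /is_general_dyckP dyckP /eq_seq_msetP.
  by rewrite seq_mset_id.
have homo : {homo Osweep phi : P / dyck_paths M P >-> dyck_paths M P}.
  move=> P [dyckP <-]; split; first exact: Osweep_dyck.
  by apply/eq_seq_msetP; exact: perm_Osweep.
have inj : set_inj (dyck_paths M) (Osweep phi).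
  move=> P P'; rewrite !inE => -[dyckP _] [dyckP' _]; exact: Osweep_inj.
split=> // Q /memE Q_s.
have [||| P P_s <-] := @inj_homo_surj_finite _ s (Osweep phi) _ _ _ Q Q_s.
- by rewrite filter_uniq ?permutations_uniq.
- by move=> P P' P_s P'_s; apply: inj; rewrite inE; apply/memE.
- by move=> P /memE/homo/memE.
by exists P => //; apply/memE.
Qed.
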